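(* Let $\alpha,\beta,\gamma,\delta\in\mathbb{R}$ with $\alpha+\delta\neq 0$ and $\alpha\gamma=0$, and let $(G_7,g,J)$ be the connected, simply connected three-dimensional Lorentzian Lie group with product structure $J$ whose Lie algebra $\mathfrak{g}$ has a pseudo-orthonormal basis $\{e_1,e_2,e_3\}$ ($e_3$ timelike) with $[e_1,e_2]=-\alpha e_1-\beta e_2-\beta e_3$, $[e_1,e_3]=\alpha e_1+\beta e_2+\beta e_3$, $[e_2,e_3]=\gamma e_1+\delta e_2+\delta e_3$. Let $c\in\mathbb{R}$. Then $(G_7,g,J)$ is a first kind algebraic Ricci soliton associated to the Kobayashi-Nomizu connection $\nabla^1$ with constant $c$ if and only if $\alpha\neq 0$, $\beta=\gamma=0$, $\alpha=2\delta$, $c=-3\delta^2$. In particular, in that case $De_1=-\delta^2e_1$, $De_2=-\delta^2e_2-\delta^2e_3$, $De_3=3\delta^2e_2+3\delta^2e_3$.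
   Context: The left-invariant Lorentzian metric $g$ satisfies $g(e_1,e_1)=g(e_2,e_2)=1$, $g(e_3,e_3)=-1$, $g(e_i,e_j)=0$ for $i\ne j$. All tensors and connections are left-invariant and evaluated on $\mathfrak{g}$. $\nabla$ is the Levi-Civita connection of $g$. The product structure is $Je_1=e_1$, $Je_2=e_2$, $Je_3=-e_3$, and $(\nabla_XJ)Y=\nabla_X(JY)-J(\nabla_XY)$. The canonical connection is $\nabla^0_XY=\nabla_XY-\frac12(\nabla_XJ)(JY)$ and the Kobayashi-Nomizu connection is $\nabla^1_XY=\nabla^0_XY-\frac14[(\nabla_YJ)(JX)-(\nabla_{JY}J)X]$, with curvature $R^1(X,Y)Z=\nabla^1_X\nabla^1_YZ-\nabla^1_Y\nabla^1_XZ-\nabla^1_{[X,Y]}Z$. Its Ricci tensor is $\rho^1(X,Y)=-g(R^1(X,e_1)Y,e_1)-g(R^1(X,e_2)Y,e_2)+g(R^1(X,e_3)Y,e_3)$ and the Ricci operator $\mathrm{Ric}^1$ is defined by $\rho^1(X,Y)=g(\mathrm{Ric}^1(X),Y)$. First kind algebraic Ricci soliton associated to $\nabla^1$ with constant $c$ means: $\mathrm{Ric}^1=c\,\mathrm{Id}+D$ where $D$ is a derivation of $\mathfrak{g}$, i.e. a linear map with $D[X,Y]=[DX,Y]+[X,DY]$ for all $X,Y\in\mathfrak{g}$. *)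

(* Defs.v *)
From HB Require Import structures.
From mathcomp Require Import all_boot all_order all_algebra.
From mathcomp Require Import reals.

Set Implicit Arguments.
Unset Strict Implicit.
Unset Printing Implicit Defensive.

Import GRing.Theory.
Local Open Scope ring_scope.

(* The Lie algebra is a finite-dimensional real vector space V with a bilinear
   bracket br.  Left-invariant tensors and connections are multilinear maps on
   V; a connection nabla X Y stands for the derivative of Y along X. *)

Definition lie_bracket (R : realType) (V : vectType R)
    (br : {bilinear V -> V -> V}) : Prop :=
  (forall X, br X X = 0) /\
  (forall X Y Z, br X (br Y Z) + br Y (br Z X) + br Z (br X Y) = 0).

Definition pseudo_orthonormal_basis (R : realType) (V : vectType R)
    (g : {symmetric V}) (e1 e2 e3 : V) : Prop :=
  [/\ basis_of {:V} [:: e1; e2; e3],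
      [/\ g e1 e1 = 1, g e2 e2 = 1 & g e3 e3 = -1]
    & [/\ g e1 e2 = 0, g e1 e3 = 0 & g e2 e3 = 0]].

Definition product_structure (R : realType) (V : vectType R)
    (J : 'End(V)) (e1 e2 e3 : V) : Prop :=
  [/\ J e1 = e1, J e2 = e2 & J e3 = - e3].

(* Torsion-free and metric.  There is no derivative term in the metric
   condition because g Y Z is constant for left-invariant Y and Z. *)
Definition levi_civita (R : realType) (V : vectType R)
    (br : {bilinear V -> V -> V}) (g : {symmetric V})
    (nabla : {bilinear V -> V -> V}) : Prop :=
  (forall X Y, nabla X Y - nabla Y X = br X Y) /\
  (forall X Y Z, g (nabla X Y) Z + g Y (nabla X Z) = 0).

(* (nabla_X J) Y *)
Definition nablaJ (R : realType) (V : vectType R) (J : 'End(V))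
    (nabla : V -> V -> V) (X Y : V) : V :=
  nabla X (J Y) - J (nabla X Y).

Definition canonical_connection (R : realType) (V : vectType R) (J : 'End(V))
    (nabla : V -> V -> V) (X Y : V) : V :=
  nabla X Y - 2^-1 *: nablaJ J nabla X (J Y).

Definition kobayashi_nomizu (R : realType) (V : vectType R) (J : 'End(V))
    (nabla : V -> V -> V) (X Y : V) : V :=
  canonical_connection J nabla X Y
  - 4^-1 *: (nablaJ J nabla Y (J X) - nablaJ J nabla (J Y) X).

Definition curvature (R : realType) (V : vectType R)
    (br nabla : V -> V -> V) (X Y Z : V) : V :=
  nabla X (nabla Y Z) - nabla Y (nabla X Z) - nabla (br X Y) Z.

(* Not symmetric in X and Y for a general connection. *)
Definition ricci_tensor (R : realType) (V : vectType R)
    (br : V -> V -> V) (g : {symmetric V}) (e1 e2 e3 : V)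
    (nabla : V -> V -> V) (X Y : V) : R :=
  - g (curvature br nabla X e1 Y) e1
  - g (curvature br nabla X e2 Y) e2
  + g (curvature br nabla X e3 Y) e3.

Definition ricci_operator (R : realType) (V : vectType R)
    (br : V -> V -> V) (g : {symmetric V}) (e1 e2 e3 : V)
    (nabla : V -> V -> V) (Ric : 'End(V)) : Prop :=
  forall X Y, ricci_tensor br g e1 e2 e3 nabla X Y = g (Ric X) Y.

Definition derivation (R : realType) (V : vectType R)
    (br : V -> V -> V) (D : 'End(V)) : Prop :=
  forall X Y, D (br X Y) = br (D X) Y + br X (D Y).

Definition soliton_derivation (R : realType) (V : vectType R)
    (br : V -> V -> V) (Ric : 'End(V)) (c : R) (D : 'End(V)) : Prop :=
  derivation br D /\ Ric = c *: \1%VF + D.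

Definition first_kind_ricci_soliton (R : realType) (V : vectType R)
    (br : V -> V -> V) (Ric : 'End(V)) (c : R) : Prop :=
  exists D : 'End(V), soliton_derivation br Ric c D.

(* Main.v *)
(* In coordinates with respect to e1, e2, e3 everything is explicit: the Koszul
   formula gives nabla, hence nabla^1, its Ricci operator, and D = Ric1 - c Id.
   Among the equations saying that D is a derivation, the e3-components at
   (e1, e2) and (e1, e3) sum to beta (alpha^2 + beta^2) = 0, so beta = 0.  If
   alpha = 0, then the e2- and e3-components at (e2, e3) force delta^3 = 0,
   contradicting alpha + delta <> 0; hence alpha <> 0 and gamma = 0.  The sum of
   the e1-component at (e1, e2) and the e1-component at (e1, e3) is then
   alpha (alpha + delta) (2 delta - alpha) = 0, and c follows. *)

Require Import Defs.
From HB Require Import structures.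
From mathcomp Require Import all_boot all_order all_algebra.
From mathcomp Require Import reals.
From mathcomp Require Import ring lra.

Set Implicit Arguments.
Unset Strict Implicit.
Unset Printing Implicit Defensive.

Import GRing.Theory Num.Theory.
Local Open Scope ring_scope.

(* Locked, so that rewriting with frameD does not see a frame in an arbitrary
   sum of three scaled vectors. *)
HB.lock Definition frame (R : realType) (V : vectType R) (e1 e2 e3 : V)
    (x y z : R) : V :=
  x *: e1 + y *: e2 + z *: e3.

(** * Coordinate calculus with respect to three vectors, later a basis *)

Section Frame.
Context (R : realType) (V : vectType R) (e1 e2 e3 : V).
Notation fr := (frame e1 e2 e3).

Lemma frame1 : e1 = fr 1 0 0.
Proof. by rewrite !frame.unlock scale1r !scale0r !addr0. Qed.

Lemma frame2 : e2 = fr 0 1 0.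
Proof. by rewrite !frame.unlock scale1r !scale0r add0r addr0. Qed.

Lemma frame3 : e3 = fr 0 0 1.
Proof. by rewrite !frame.unlock scale1r !scale0r !add0r. Qed.

Lemma frameD x y z x' y' z' :
  fr x y z + fr x' y' z' = fr (x + x') (y + y') (z + z').
Proof. by rewrite !frame.unlock addrACA (addrACA (x *: e1)) -!scalerDl. Qed.

Lemma frameZ a x y z : a *: fr x y z = fr (a * x) (a * y) (a * z).
Proof. by rewrite frame.unlock !scalerDr !scalerA. Qed.

Lemma frameN x y z : - fr x y z = fr (- x) (- y) (- z).
Proof. by rewrite -scaleN1r frameZ !mulN1r. Qed.

Definition frameE := (frameD, frameZ, frameN).

Lemma linear_frame (W : lmodType R) (f : {linear V -> W}) x y z :
  f (fr x y z) = x *: f e1 + y *: f e2 + z *: f e3.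
Proof. by rewrite !frame.unlock !linearD !linearZ. Qed.

Lemma bilinear_frame (f : {bilinear V -> V -> V}) x y z x' y' z' :
  f (fr x y z) (fr x' y' z') =
    x *: (x' *: f e1 e1 + y' *: f e1 e2 + z' *: f e1 e3) +
    y *: (x' *: f e2 e1 + y' *: f e2 e2 + z' *: f e2 e3) +
    z *: (x' *: f e3 e1 + y' *: f e3 e2 + z' *: f e3 e3).
Proof.
by rewrite !frame.unlock !linearDl !linearZl_LR !linearDr !linearZr_LR.
Qed.

Hypothesis basis_e : basis_of {:V} [:: e1; e2; e3].

Lemma frame_ex v : exists x y z, v = fr x y z.
Proof.
have := coord_basis (X := [tuple of [:: e1; e2; e3]]) basis_e (memvf v).
rewrite !big_ord_recl big_ord0 addr0 addrA => ->.
by eexists; eexists; eexists; rewrite frame.unlock.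
Qed.

Lemma frame_inj x y z x' y' z' :
  fr x y z = fr x' y' z' -> [/\ x = x', y = y' & z = z'].
Proof.
move=> /eqP; rewrite -subr_eq0 !frameE frame.unlock => /eqP eq0.
have /freeP freeE := (basis_free basis_e : free [tuple of [:: e1; e2; e3]]).
have := freeE (fun i => [:: x - x'; y - y'; z - z']`_i).
rewrite !big_ord_recl big_ord0 addr0 addrA => /(_ eq0) k0.
have := (k0 ord0, k0 (inord 1), k0 (inord 2)); rewrite !inordK //= => -[[]].
by move=> /subr0_eq -> /subr0_eq -> /subr0_eq ->.
Qed.

End Frame.

(** Torsion-freeness turns the three brackets into six terms in [nabla]. Metricity at the cyclic
    permutations of [X], [Y], [Z] cancels four of them and makes the other two equal. *)
Lemma koszul (R : realType) (V : vectType R) (br : {bilinear V -> V -> V})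
    (g : {symmetric V}) (nabla : {bilinear V -> V -> V}) X Y Z :
  levi_civita br g nabla ->
  g (nabla X Y) Z = 2^-1 * (g (br X Y) Z - g (br Y Z) X + g (br Z X) Y).
Proof.
move=> [tor met].
(* A symmetric form is a hermitian form with sign [(-1) ^+ 0], hence [expr0]. *)
have gC u v : g u v = g v u by rewrite hermC expr0 mul1r.
have := (met X Y Z, met Y Z X, met Z X Y).
rewrite -!tor !linearBl /= (gC Y) (gC Z) (gC X) => -[[E1 E2] E3].
move: E1 E2 E3 => /eqP; rewrite addrC addr_eq0 => /eqP ->.
move=> /eqP; rewrite addrC addr_eq0 => /eqP ->.
by move=> /eqP; rewrite addrC addr_eq0 => /eqP ->; field.
Qed.

Lemma bracketC (R : realType) (V : vectType R) (br : {bilinear V -> V -> V})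
    X Y :
  lie_bracket br -> br X Y = - br Y X.
Proof.
move=> [alt _]; apply/eqP; rewrite -addr_eq0; apply/eqP.
by have := alt (X + Y); rewrite linearDl /= !linearDr /= !alt add0r addr0.
Qed.

(** * The Lorentzian metric in coordinates *)

Section PseudoOrthonormal.
Context (R : realType) (V : vectType R) (g : {symmetric V}) (e1 e2 e3 : V).
Hypothesis pon : pseudo_orthonormal_basis g e1 e2 e3.
Notation fr := (frame e1 e2 e3).

Lemma metric_frame x y z x' y' z' :
  g (fr x y z) (fr x' y' z') = x * x' + y * y' - z * z'.
Proof.
have gC u v : g u v = g v u by rewrite hermC expr0 mul1r.
have [_ [g11 g22 g33] [g12 g13 g23]] := pon.
rewrite !frame.unlock !linearDl /= !linearZl_LR /= !linearDr /= !linearZr_LR /=.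
by rewrite (gC e2 e1) (gC e3 e1) (gC e3 e2) g11 g22 g33 g12 g13 g23; ring.
Qed.

Lemma metric_frame1 x y z : g (fr x y z) e1 = x.
Proof. by rewrite [X in g _ X](frame1 e1 e2 e3) metric_frame; ring. Qed.

Lemma metric_frame2 x y z : g (fr x y z) e2 = y.
Proof. by rewrite [X in g _ X](frame2 e1 e2 e3) metric_frame; ring. Qed.

Lemma metric_frame3 x y z : g (fr x y z) e3 = - z.
Proof. by rewrite [X in g _ X](frame3 e1 e2 e3) metric_frame; ring. Qed.

(** The sign comes from [e3] being timelike. This recovers vectors known only through their pairings
    under [g], namely the values of [nabla] and [Ric1]. *)
Lemma frame_coord v : v = fr (g v e1) (g v e2) (- g v e3).
Proof.
have [basis_e _ _] := pon; have [x [y [z ->]]] := frame_ex basis_e v.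
by rewrite metric_frame1 metric_frame2 metric_frame3 opprK.
Qed.

End PseudoOrthonormal.

(** * Connections and Ricci operator of the Lie algebra, in coordinates *)

Section G7.
Context (R : realType) (alpha beta gamma delta : R)
    (V : vectType R) (br : {bilinear V -> V -> V}) (g : {symmetric V})
    (J : 'End(V)) (e1 e2 e3 : V)
    (nabla : {bilinear V -> V -> V}) (Ric1 : 'End(V)).
Hypotheses (h_lie : lie_bracket br)
    (h_basis : pseudo_orthonormal_basis g e1 e2 e3)
    (h_J : product_structure J e1 e2 e3)
    (h12 : br e1 e2 = - alpha *: e1 - beta *: e2 - beta *: e3)
    (h13 : br e1 e3 = alpha *: e1 + beta *: e2 + beta *: e3)
    (h23 : br e2 e3 = gamma *: e1 + delta *: e2 + delta *: e3)
    (h_nabla : levi_civita br g nabla)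
    (h_Ric1 : ricci_operator br g e1 e2 e3 (kobayashi_nomizu J nabla) Ric1).
Notation fr := (frame e1 e2 e3).

(** The bracket is alternating, so only the 2x2 minors [p], [q], [r] enter. *)
Lemma bracket_frame x y z x' y' z' :
  let p := x * y' - y * x' in
  let q := x * z' - z * x' in
  let r := y * z' - z * y' in
  br (fr x y z) (fr x' y' z') =
    fr (alpha * (q - p) + gamma * r)
       (beta * (q - p) + delta * r)
       (beta * (q - p) + delta * r).
Proof.
move=> p q r; have [alt _] := h_lie.
have fr0 : 0 = fr 0 0 0 by rewrite !frame.unlock !scale0r !addr0.
have b12 : br e1 e2 = fr (- alpha) (- beta) (- beta).
  by rewrite h12 !frame.unlock !scaleNr.
have b13 : br e1 e3 = fr alpha beta beta by rewrite frame.unlock.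
have b23 : br e2 e3 = fr gamma delta delta by rewrite frame.unlock.
rewrite bilinear_frame !alt (bracketC e2 e1) // (bracketC e3 e1) //.
rewrite (bracketC e3 e2) // b12 b13 b23 fr0 !frameE.
by congr frame; rewrite /p /q /r; ring.
Qed.

Lemma levi_civita_frame x y z x' y' z' :
  nabla (fr x y z) (fr x' y' z') =
    fr (x * (alpha * (z' - y')) + y * (2^-1 * gamma * z' + beta * (z' - y'))
          + z * ((beta - 2^-1 * gamma) * y' - beta * z'))
       (x * (alpha * x' + 2^-1 * gamma * z') + y * (beta * x' + delta * z')
          + z * ((2^-1 * gamma - beta) * x' - delta * z'))
       (x * (alpha * x' + 2^-1 * gamma * y')
          + y * ((2^-1 * gamma + beta) * x' + delta * y')
          - z * (beta * x' + delta * y')).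
Proof.
set v := nabla _ _.
have gv a b d : g v (fr a b d) = 2^-1 * (
    g (br (fr x y z) (fr x' y' z')) (fr a b d)
    - g (br (fr x' y' z') (fr a b d)) (fr x y z)
    + g (br (fr a b d) (fr x y z)) (fr x' y' z')) by exact: koszul.
(* Testing against [e1], [e2], [e3] determines [v]. *)
have {gv} [[g1 g2] g3] := (gv 1 0 0, gv 0 1 0, gv 0 0 1).
rewrite !bracket_frame !(metric_frame h_basis) in g1 g2 g3.
rewrite -frame1 in g1; rewrite -frame2 in g2; rewrite -frame3 in g3.
rewrite (frame_coord h_basis v) g1 g2 g3.
by congr frame; field.
Qed.

Lemma product_frame x y z : J (fr x y z) = fr x y (- z).
Proof.
have [J1 J2 J3] := h_J.
by rewrite linear_frame /= J1 J2 J3 !frame.unlock scalerN scaleNr.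
Qed.

(** The first two coordinates involve only [x'], [y'] and the third only [z']: this connection
    preserves the eigenspaces of [J]. *)
Lemma kobayashi_nomizu_frame x y z x' y' z' :
  kobayashi_nomizu J nabla (fr x y z) (fr x' y' z') =
    fr (- x * (alpha * y') - y * (beta * y') - z * (alpha * x' + gamma * y'))
       (x * (alpha * x') + y * (beta * x') - z * (beta * x' + delta * y'))
       (x * (beta * z') + y * (delta * z')).
Proof.
rewrite /kobayashi_nomizu /canonical_connection /nablaJ.
rewrite !(product_frame, levi_civita_frame, frameE).
by congr frame; field.
Qed.

Lemma ricci_operator_frame x y z :
  Ric1 (fr x y z) =
    fr (- alpha ^+ 2 * x - alpha * beta * y + beta * (alpha + delta) * z)
       (beta * delta * x - (alpha ^+ 2 + beta ^+ 2 + beta * gamma) * y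
          + delta * (alpha + delta) * z)
       (- beta * (alpha + delta) * x - (beta * gamma + delta ^+ 2) * y).
Proof.
have [k1 k2 k3] := And3 (kobayashi_nomizu_frame 1 0 0)
  (kobayashi_nomizu_frame 0 1 0) (kobayashi_nomizu_frame 0 0 1).
have [b1 b2 b3] := And3 (bracket_frame x y z 1 0 0)
  (bracket_frame x y z 0 1 0) (bracket_frame x y z 0 0 1).
(* The basis vectors occur unexpanded as directions in [ricci_tensor], so these rules must be stated
   for [e1], [e2], [e3] themselves. *)
rewrite -frame1 /= in k1 b1; rewrite -frame2 /= in k2 b2.
rewrite -frame3 /= in k3 b3.
set v := Ric1 _.
have gv a b d : g v (fr a b d) =
    ricci_tensor br g e1 e2 e3 (kobayashi_nomizu J nabla)
      (fr x y z) (fr a b d) by rewrite h_Ric1.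
have {gv} [[g1 g2] g3] := (gv 1 0 0, gv 0 1 0, gv 0 0 1).
rewrite /ricci_tensor /curvature b1 b2 b3 in g1 g2 g3.
rewrite !(k1, k2, k3, kobayashi_nomizu_frame, frameE) in g1 g2 g3.
rewrite !(metric_frame1, metric_frame2, metric_frame3) // in g1 g2 g3.
rewrite -frame1 in g1; rewrite -frame2 in g2; rewrite -frame3 in g3.
rewrite (frame_coord h_basis v) g1 g2 g3.
by congr frame; ring.
Qed.

Lemma soliton_endo_frame c D x y z :
  Ric1 = c *: \1%VF + D ->
  D (fr x y z) =
    fr ((- alpha ^+ 2 - c) * x - alpha * beta * y
          + beta * (alpha + delta) * z)
       (beta * delta * x - (alpha ^+ 2 + beta ^+ 2 + beta * gamma + c) * y
          + delta * (alpha + delta) * z)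
       (- beta * (alpha + delta) * x - (beta * gamma + delta ^+ 2) * y - c * z).
Proof.
move=> RicE; have -> : D (fr x y z) = Ric1 (fr x y z) - c *: fr x y z.
  by rewrite RicE add_lfunE scale_lfunE id_lfunE addrC addKr.
by rewrite ricci_operator_frame !frameE; congr frame; ring.
Qed.

End G7.

(* The hypotheses are coordinates of D[X, Y] = [DX, Y] + [X, DY]: the e1- and
   e3-components at (e1, e2) and at (e1, e3), then the e2- and e3-components at
   (e2, e3). *)
Lemma soliton_parameters (R : realFieldType) (alpha beta gamma delta c : R) :
  alpha + delta != 0 -> alpha * gamma = 0 ->
  alpha * (delta ^+ 2 - alpha ^+ 2 - c)
    - beta * (alpha * beta + alpha * gamma + beta * delta + gamma * delta)
    = 0 ->
  beta * (delta ^+ 2 + beta * gamma - alpha ^+ 2 - beta ^+ 2 - c) = 0 ->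
  alpha * (delta ^+ 2 + alpha * delta + c)
    + beta * delta * (beta - gamma) = 0 ->
  beta * (c - delta ^+ 2 - beta * gamma) = 0 ->
  delta * (c + delta ^+ 2 + alpha * delta + beta * gamma - beta ^+ 2) = 0 ->
  delta * (c - delta ^+ 2 + alpha ^+ 2 - beta * gamma)
    - alpha * beta * gamma = 0 ->
  [/\ alpha != 0, beta = 0 /\ gamma = 0, alpha = 2 * delta
    & c = - 3 * delta ^+ 2].
Proof.
move=> ad ag E0 E2 E3 E5 E7 E8.
have b0 : beta = 0.
  have : beta * (alpha ^+ 2 + beta ^+ 2) = 0 by lra.
  by move=> /eqP; rewrite mulf_eq0 paddr_eq0 ?sqr_ge0 // !sqrf_eq0
    => /orP[|/andP[_]] /eqP.
rewrite b0 !(mul0r, mulr0, addr0, subr0) {E2 E5} in E0 E3 E7 E8.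
have a0 : alpha != 0.
  apply: contra_neq ad => a0; rewrite a0 add0r in E7 E8 *.
  (* [E7] and [E8] now read [delta * (c + delta ^+ 2) = 0] and [delta * (c - delta ^+ 2) = 0]; half
     their difference is the claim. *)
  have /eqP : delta ^+ 3 = 0 by lra.
  by rewrite expf_eq0 => /eqP.
have g0 : gamma = 0 by move/eqP: ag; rewrite mulf_eq0 (negbTE a0) => /eqP.
have a2d : alpha = 2 * delta.
  have /eqP : alpha * ((alpha + delta) * (2 * delta - alpha)) = 0 by lra.
  by rewrite !mulf_eq0 (negbTE a0) (negbTE ad) subr_eq0 => /eqP.
(* Replacing only the inner [alpha] turns [E3] into [alpha * (3 * delta ^+ 2 + c) = 0], which is
   linear in the monomials of the goal multiplied by [alpha]. *)
split=> //; apply: (mulfI a0); rewrite {2}a2d in E3; lra.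
Qed.

Theorem theorem3p26 (R : realType) (alpha beta gamma delta c : R)
    (V : vectType R) (br : {bilinear V -> V -> V}) (g : {symmetric V})
    (J : 'End(V)) (e1 e2 e3 : V)
    (nabla : {bilinear V -> V -> V}) (Ric1 : 'End(V))
    (h_ad : alpha + delta != 0) (h_ag : alpha * gamma = 0)
    (h_lie : lie_bracket br)
    (h_basis : pseudo_orthonormal_basis g e1 e2 e3)
    (h_J : product_structure J e1 e2 e3)
    (h12 : br e1 e2 = - alpha *: e1 - beta *: e2 - beta *: e3)
    (h13 : br e1 e3 = alpha *: e1 + beta *: e2 + beta *: e3)
    (h23 : br e2 e3 = gamma *: e1 + delta *: e2 + delta *: e3)
    (h_nabla : levi_civita br g nabla)
    (h_Ric1 : ricci_operator br g e1 e2 e3 (kobayashi_nomizu J nabla) Ric1) :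
  (first_kind_ricci_soliton br Ric1 c <->
     [/\ alpha != 0, beta = 0 /\ gamma = 0, alpha = 2 * delta
       & c = - 3 * delta ^+ 2]) /\
  (forall D : 'End(V), soliton_derivation br Ric1 c D ->
     [/\ D e1 = - delta ^+ 2 *: e1,
         D e2 = - delta ^+ 2 *: e2 - delta ^+ 2 *: e3
       & D e3 = 3 * delta ^+ 2 *: e2 + 3 * delta ^+ 2 *: e3]).
Proof.
have [basis_e _ _] := h_basis.
have brE := bracket_frame h_lie h12 h13 h23.
have DE := soliton_endo_frame
  h_lie h_basis h_J h12 h13 h23 h_nabla h_Ric1.
have params D : soliton_derivation br Ric1 c D ->
    [/\ alpha != 0, beta = 0 /\ gamma = 0, alpha = 2 * delta
      & c = - 3 * delta ^+ 2].
  move=> solD; have [der RicE] := solD.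
  (* Each of the three basis pairs yields three scalar equations, [E0] to [E8] in all. *)
  have [] := And3 (der (frame e1 e2 e3 1 0 0) (frame e1 e2 e3 0 1 0))
    (der (frame e1 e2 e3 1 0 0) (frame e1 e2 e3 0 0 1))
    (der (frame e1 e2 e3 0 1 0) (frame e1 e2 e3 0 0 1)).
  rewrite !(brE, DE _ _ _ _ _ RicE) !frameE.
  move=> /(frame_inj basis_e)[E0 E1 E2] /(frame_inj basis_e)[E3 E4 E5].
  move=> /(frame_inj basis_e)[E6 E7 E8].
  by apply: soliton_parameters => //; lra.
split.
  split=> [[D /params] //|[a0 [b0 g0] ad cd]].
  (* The soliton equation forces this choice of [D]; the derivation rule is then a polynomial
     identity in the coordinates and [delta]. *)
  have RicE : Ric1 = c *: \1%VF + (Ric1 - c *: \1%VF) by rewrite addrC subrK.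
  exists (Ric1 - c *: \1%VF); split=> // X Y.
  have [x [y [z ->]]] := frame_ex basis_e X.
  have [x' [y' [z' ->]]] := frame_ex basis_e Y.
  rewrite !(brE, DE _ _ _ _ _ RicE) !frameE b0 g0 ad cd.
  by congr frame; ring.
move=> D solD; have [_ [b0 g0] ad cd] := params _ solD.
have [_ RicE] := solD; split.
- transitivity (frame e1 e2 e3 (- delta ^+ 2) 0 0); last first.
    by rewrite frame.unlock !scale0r ?scaleNr ?addr0 ?add0r.
  (* Only the argument of [D] is expanded; the [e1] inside the frame on the right must stay. *)
  rewrite {1}(frame1 e1 e2 e3) (DE _ _ _ _ _ RicE) b0 g0 ad cd.
  by congr frame; ring.
- transitivity (frame e1 e2 e3 0 (- delta ^+ 2) (- delta ^+ 2)); last first.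
    by rewrite frame.unlock !scale0r ?scaleNr ?addr0 ?add0r.
  rewrite {1}(frame2 e1 e2 e3) (DE _ _ _ _ _ RicE) b0 g0 ad cd.
  by congr frame; ring.
- transitivity (frame e1 e2 e3 0 (3 * delta ^+ 2) (3 * delta ^+ 2)); last first.
    by rewrite frame.unlock !scale0r ?scaleNr ?addr0 ?add0r.
  rewrite {1}(frame3 e1 e2 e3) (DE _ _ _ _ _ RicE) b0 g0 ad cd.
  by congr frame; ring.
Qed.
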